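(* For any $0<\alpha<1$ and $\mu>0$, there exist positive constants $\bar C_1^\alpha$ and $\bar C_2^\alpha$ such that for the hard copying random graph process $\{\bar G_t^\alpha:t\ge1\}$ with parameters $\alpha,\mu$, $$\bar C_1^\alpha k^{-1/\alpha}\le\liminf_{t\to\infty}\frac{\overline{D}_k(t)}{t}\le\limsup_{t\to\infty}\frac{\overline{D}_k(t)}{t}\le\bar C_2^\alpha k^{-1/\alpha}$$ for all $k\ge1$.
   Context: Here $u\wedge v=\min(u,v)$. For constants $0\le\alpha\le1$ and $\mu>0$, the (hard copying) random graph process $\{\bar G^\alpha_t=(V_t,E_t):t\ge1\}$ is defined as follows. Time-Step 1: $\bar G_1^\alpha$ consists of two vertices $x_0,x_1$ and the edge $\langle x_0,x_1\rangle$. Time-Step $t\ge2$: (1) with probability $\alpha$, the new vertex $x_t$ is generated by copying an existing vertex $x_i$, $0\le i\le t-1$, chosen from $V_{t-1}$ uniformly at random; in this case the neighbors of $x_t$ are exactly the neighbors of the copied vertex $x_i$ in $\bar G^\alpha_{t-1}$; (2) with probability $1-\alpha$, a new vertex $x_t$ is added to $\bar G^\alpha_{t-1}$ and random edges incident with $x_t$ are added in the classical manner: for each $0\le i\le t-1$, the edge $\langle x_i,x_t\rangle$ is added independently with probability $(\mu\wedge t)/t$. $D_k(t)$ denotes the number of vertices of degree $k$ in $\bar G^\alpha_t$ and $\overline{D}_k(t)=\mathbb{E}(D_k(t))$. *)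

(* Defs.v *)
From HB Require Import structures.
From mathcomp Require Import all_boot all_order all_algebra.
From mathcomp Require Import all_classical all_reals all_analysis.

Set Implicit Arguments.
Unset Strict Implicit.
Unset Printing Implicit Defensive.

Import Order.TTheory GRing.Theory Num.Theory.

Local Open Scope ring_scope.

Definition is_sgraph n (A : 'M[bool]_n) : bool :=
  [forall i, ~~ A i i] && [forall i, forall j, A i j == A j i].

(* Finite simple graphs with vertex set 'I_n, as adjacency matrices. *)
Record sgraph n := SGraph { adj : 'M[bool]_n ; sgraphP : is_sgraph adj }.

HB.instance Definition _ n := [isSub for @adj n].
HB.instance Definition _ n := [Finite of sgraph n by <:].

Definition nbrs n (g : sgraph n) (v : 'I_n) : {set 'I_n} :=
  [set w | adj g v w].

Definition deg n (g : sgraph n) (v : 'I_n) : nat := #|nbrs g v|.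

Definition ndeg k n (g : sgraph n) : nat := #|[set v | deg g v == k]|.

Definition K2_adj : 'M[bool]_2 := \matrix_(i, j) (i != j).

Lemma K2_subproof : is_sgraph K2_adj.
Proof.
apply/andP; split; first by apply/forallP => i; rewrite mxE eqxx.
by apply/forallP => i; apply/forallP => j; rewrite !mxE (eq_sym j).
Qed.

Definition K2 : sgraph 2 := SGraph K2_subproof.

(* [attach g S] adds to g the new vertex ord_max, with neighbourhood S; the
   old vertices are embedded by [lift ord_max], which keeps their values. *)
Definition attach_adj n (g : sgraph n) (S : {set 'I_n}) : 'M[bool]_n.+1 :=
  \matrix_(i, j)
    match unlift ord_max i, unlift ord_max j with
    | Some u, Some v => adj g u v
    | Some u, None => u \in S
    | None, Some v => v \in S
    | None, None => false
    end.

Lemma attach_subproof n (g : sgraph n) S : is_sgraph (attach_adj g S).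
Proof.
have /andP[/forallP irr /forallP sym] := sgraphP g.
apply/andP; split.
  by apply/forallP => i; rewrite mxE; case: unliftP => [u _|_] //.
apply/forallP => i; apply/forallP => j; rewrite !mxE.
case: (unlift ord_max i) => [u|]; case: (unlift ord_max j) => [v|] //.
by have /forallP/(_ v) := sym u.
Qed.

Definition attach n (g : sgraph n) (S : {set 'I_n}) : sgraph n.+1 :=
  SGraph (attach_subproof g S).

Section hard_copying.
Context {R : realType} (alpha mu : R).

(* Probability of passing from g, which has t vertices x_0, ..., x_(t-1), to h
   at time-step t. The first summand copies a uniformly chosen vertex i; the
   second one joins x_t to each old vertex independently with probability
   (mu /\ t) / t, so that its neighbourhood is S with probability the product
   below. *)
Definition copy_step t (g : sgraph t) (h : sgraph t.+1) : R :=
  alpha * (\sum_(i < t | h == attach g (nbrs g i)) t%:R^-1)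
  + (1 - alpha) *
    \sum_(S : {set 'I_t} | h == attach g S)
      \prod_(i < t) (let p := Num.min mu t%:R / t%:R in
                     if i \in S then p else 1 - p).

Local Open Scope classical_set_scope.

(* The random graph at time t >= 1 is [G t], on the vertices x_0, ..., x_t.
   [G 0] is not part of the process and is unconstrained. *)
Definition hard_copying_process d (Omega : measurableType d)
    (P : probability Omega R) (G : forall t, Omega -> sgraph t.+1) : Prop :=
  [/\ (forall t (g : sgraph t.+1), (1 <= t)%N ->
         measurable [set w | G t w = g]),
      P [set w | G 1%N w = K2] = 1%E &
      forall t (g : forall s, sgraph s.+1), (1 <= t)%N ->
        let history := [set w | forall s, (1 <= s <= t)%N -> G s w = g s] in
        P (history `&` [set w | G t.+1 w = g t.+1]) =
        (P history * (copy_step (g t) (g t.+1))%:E)%E].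

End hard_copying.

(* The expected number of vertices of degree k at time t. *)
Definition mean_ndeg {R : realType} d (Omega : measurableType d)
    (P : probability Omega R) (G : forall t, Omega -> sgraph t.+1)
    (k t : nat) : \bar R :=
  ('E_P[fun w => (ndeg k (G t w))%:R])%E.

(* Main.v *)
Require Import Defs.
From mathcomp Require Import all_boot all_order all_algebra.
From mathcomp Require Import all_classical all_reals all_analysis.
From mathcomp Require Import measurable_realfun.
From mathcomp Require Import ring lra.

(** The proof is a comparison argument for the recursion satisfied by the
    expected degree counts.

    Let [n = t + 1] be the number of vertices at time [t], and let [d k n] be
    the expected number of those of degree [k].  When a vertex is copied, its
    copy has its degree, so a uniform copy adds [d k n / n] vertices of degree
    [k] on average.  An old vertex of degree [k] gains an edge with
    probability [(alpha * k + (1 - alpha) * mu) / n]: it must be adjacent to the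
    copied vertex, or be selected in the classical manner.  Summing up, with
    [a k = alpha * k + (1 - alpha) * mu] and [n >= mu],

      [d (k+1) (n+1) = (1 - a k / n) d (k+1) n + (a k / n) d k n + q (k+1) n],

    where [q j n] is [1 - alpha] times the probability that a binomial variable
    with parameters [n] and [mu / n] takes the value [j]
    ([copy_step_ndeg], [mean_deg_count_recursion]).  The coefficient of the first
    term would be [1 - a (k+1) / n] without the copies, and this shift is what
    gives the exponent [1 / alpha]: a linear profile [d k n = w k * n] solves the
    recursion without [q] when [(1 + a k) w (k+1) = a k * w k], and as
    [a k = alpha * (k + r)] for [r = (1 - alpha) * mu / alpha], the ratio of
    consecutive terms is [1 - (1 / alpha) / k + O(1 / k ^ 2)].

    Instead of solving this with Gamma functions, the proof uses two shifted
    powers.  Young's inequality shows that [(k + r) ^ (- 1 / alpha)] is a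
    subsolution of the linear relation ([powR_subsolution]) and that
    [(k + r + 1 / alpha - 1) ^ (- 1 / alpha)] is a supersolution
    ([powR_supersolution]).

    - Lower bound ([lower_bound]): the term [q 1 n] stays above a positive
      constant, which makes [d 1 n] grow linearly, and the subsolution carries
      linear growth from [k] to [k + 1].  Each [k] costs an additive constant,
      which disappears in the lower limit of [d k n / n].

    - Upper bound ([upper_bound]): the term [q k n] is at most [mu ^ k / k!],
      whose quotient by the supersolution is summable in [k].  Multiplying the
      supersolution by the partial sums gives a profile that dominates [d k n]
      for all [k] and all large [n] at once.

    The law of the graph at time [t + 1] depends on the law at time [t] only,
    because the prescribed conditional probabilities given the history depend on
    its last graph only ([markov_step], [law_step]). *)

Set Implicit Arguments.
Unset Strict Implicit.
Unset Printing Implicit Defensive.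

Import Order.TTheory GRing.Theory Num.Theory.

Local Open Scope ring_scope.

(** * Degrees after one attachment *)
Lemma degE n (g : sgraph n) v : deg g v = (\sum_w adj g v w)%N.
Proof.
by rewrite /deg -sum1_card big_mkcond; apply: eq_bigr => w _; rewrite inE; case: adj.
Qed.

Lemma nbrs_sym n (g : sgraph n) v w : (v \in nbrs g w) = (w \in nbrs g v).
Proof.
by rewrite !inE; have /andP[_ /forallP/(_ v)/forallP/(_ w)/eqP ->] := sgraphP g.
Qed.

Lemma ndegE k n (g : sgraph n) : ndeg k g = (\sum_v (deg g v == k))%N.
Proof.
by rewrite /ndeg -sum1_card big_mkcond; apply: eq_bigr => w _; rewrite inE; case: eqP.
Qed.

Lemma ndeg_le k n (g : sgraph n) : (ndeg k g <= n)%N.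
Proof. by rewrite -[leqRHS]card_ord max_card. Qed.

Lemma deg_lt n (g : sgraph n) v : (deg g v < n)%N.
Proof.
rewrite -[ltnRHS]card_ord /deg -cardsT; apply: proper_card.
apply/properP; split; first exact: finset.subsetT.
exists v; rewrite // inE.
by have /andP[/forallP/(_ v)] := sgraphP g.
Qed.

Lemma ndeg_eq0 k n (g : sgraph n) : (n <= k)%N -> ndeg k g = 0%N.
Proof.
move=> nk; rewrite ndegE big1 // => v _.
by rewrite ltn_eqF // (leq_trans (deg_lt g v)).
Qed.

Section attach.
Context n (g : sgraph n) (S : {set 'I_n}).

Lemma deg_attach_new : deg (attach g S) ord_max = #|S|.
Proof.
rewrite degE (bigD1_ord ord_max) //= mxE unlift_none add0n -sum1_card [RHS]big_mkcond.
by apply: eq_bigr => w _; rewrite mxE unlift_none liftK; case: ifP.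
Qed.

Lemma deg_attach_old v :
  deg (attach g S) (lift ord_max v) = (deg g v + (v \in S))%N.
Proof.
rewrite !degE (bigD1_ord ord_max) //= mxE unlift_none liftK addnC; congr addn.
by apply: eq_bigr => w _; rewrite mxE !liftK.
Qed.

(** Only the vertices of degree [k] and [k.+1] can have degree [k.+1] after the
    attachment.  Written with indicators that are affine in [v \in S], the count
    can be averaged over a random [S] by linearity. *)
Lemma ndeg_attach (R : pzRingType) k :
  (ndeg k.+1 (attach g S))%:R = (#|S| == k.+1)%:R
    + \sum_v ((deg g v == k)%:R * (v \in S)%:R
              + (deg g v == k.+1)%:R * (1 - (v \in S)%:R)) :> R.
Proof.
rewrite ndegE (bigD1_ord ord_max) //= deg_attach_new natrD natr_sum; congr +%R.
apply: eq_bigr => v _; rewrite deg_attach_old; case: (v \in S).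
  by rewrite addn1 eqSS mulr1 subrr mulr0 addr0.
by rewrite addn0 mulr0 subr0 mulr1 add0r.
Qed.

End attach.

(** By linearity the joint law of the random neighbourhood [S i] matters only
    through its size and through the probabilities [m v] that it contains [v];
    this covers both kinds of steps. *)
Lemma mean_ndeg_attach (R : comNzRingType) n (g : sgraph n) (I : finType)
    (W : I -> R) (S : I -> {set 'I_n}) (m : 'I_n -> R) k :
  \sum_i W i = 1 -> (forall v, \sum_i W i * (v \in S i)%:R = m v) ->
  \sum_i W i * (ndeg k.+1 (attach g (S i)))%:R =
  \sum_i W i * (#|S i| == k.+1)%:R
  + \sum_v ((deg g v == k)%:R * m v + (deg g v == k.+1)%:R * (1 - m v)).
Proof.
move=> W1 Wm; under eq_bigr do rewrite ndeg_attach mulrDr mulr_sumr.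
rewrite big_split exchange_big /=; congr +%R; apply: eq_bigr => v _.
rewrite -Wm [in RHS](_ : 1 - _ = \sum_i W i - \sum_i W i * (v \in S i)%:R);
  last by rewrite W1.
rewrite -sumrB !mulr_sumr -big_split /=.
apply: eq_bigr => i _.
by move: _%:R _%:R _%:R => x y z; ring.
Qed.

(** A vertex [v] is joined to the copy of a uniform vertex with probability
    [deg g v / n].  The loss at degree [k.+1] would be [k.+1 / n]; the copies of
    vertices of degree [k.+1] give [1 / n] back. *)
Lemma mean_ndeg_copy (R : numFieldType) n (g : sgraph n) k : (0 < n)%N ->
  \sum_(i < n) n%:R^-1 * (ndeg k.+1 (attach g (nbrs g i)))%:R =
  (1 - k%:R / n%:R) * (ndeg k.+1 g)%:R + k%:R / n%:R * (ndeg k g)%:R :> R.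
Proof.
move=> n0; have n0' : n%:R != 0 :> R by rewrite pnatr_eq0 -lt0n.
rewrite (@mean_ndeg_attach _ n g _ _ _ (fun v => (deg g v)%:R / n%:R)).
- rewrite !ndegE !natr_sum !mulr_sumr -!big_split /=.
  apply: eq_bigr => v _; rewrite -/(deg g v).
  have [->|_] := eqVneq (deg g v) k.
    by rewrite ltn_eqF //=; field.
  have [->|_] := eqVneq (deg g v) k.+1; last by rewrite /=; field.
  by rewrite /= -natr1; field.
- by rewrite sumr_const card_ord -(mulr_natr n%:R^-1) mulVf.
- move=> v; rewrite -mulr_sumr mulrC; congr (_ * _).
  rewrite degE natr_sum; apply: eq_bigr => i _.
  by rewrite nbrs_sym inE.
Qed.

Section bernoulli_subset.
Context {R : comNzRingType} (n : nat) (p : R).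

Definition bernoulli_weight (S : {set 'I_n}) : R :=
  \prod_(i < n) if i \in S then p else 1 - p.

Lemma sum_subset_prod (F G : 'I_n -> R) :
  \sum_(S : {set 'I_n}) \prod_(i < n) (if i \in S then F i else G i)
  = \prod_(i < n) (F i + G i).
Proof. by rewrite bigA_distr; apply: eq_bigl. Qed.

Lemma sum_bernoulli_weight : \sum_S bernoulli_weight S = 1.
Proof.
rewrite /bernoulli_weight sum_subset_prod.
by rewrite big1 // => i _; rewrite subrKC.
Qed.

(** Expanding a product in which the factor [1 - p] of [v] is replaced by zero
    keeps exactly the subsets that contain [v]. *)
Lemma bernoulli_weight_mem v :
  \sum_S bernoulli_weight S * (v \in S)%:R = p.
Proof.
rewrite [LHS](_ : _ = \sum_(S : {set 'I_n})
    \prod_(i < n) (if i \in S then p else (1 - p) * (i != v)%:R)).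
  rewrite sum_subset_prod.
  rewrite (bigD1 v) //= eqxx mulr0 addr0 big1 ?mulr1 // => i /negPf ->.
  by rewrite mulr1 subrKC.
apply: eq_bigr => S _; rewrite /bernoulli_weight; case: (boolP (v \in S)) => vS.
  rewrite mulr1; apply: eq_bigr => i _; case: ifP => // iS.
  by rewrite (_ : i != v) ?mulr1 //; apply/eqP => iv; rewrite iv vS in iS.
by rewrite mulr0 (bigD1 v) //= (negPf vS) eqxx mulr0 mul0r.
Qed.

Lemma bernoulli_weight_card k :
  \sum_S bernoulli_weight S * (#|S| == k)%:R
  = 'C(n, k)%:R * p ^+ k * (1 - p) ^+ (n - k).
Proof.
have -> : 'C(n, k) = #|[set A : {set 'I_n} | #|A| == k]|.
  by rewrite card_draws card_ord.
rewrite -sum1_card natr_sum !mulr_suml.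
rewrite [RHS]big_mkcond /=; apply: eq_bigr => S _.
rewrite inE; case: eqP => [<-|_]; last by rewrite mulr0.
rewrite mulr1 mul1r /bernoulli_weight (bigID (mem S)) /=; congr (_ * _).
  by rewrite -prodr_const; apply: eq_bigr => i ->.
rewrite (_ : (n - #|S| = #|~: S|)%N); last first.
  by rewrite [#|~: S|]cardsCs finset.setCK card_ord.
rewrite -prodr_const; apply: eq_big => [i|i /negPf ->] //.
by rewrite inE.
Qed.

End bernoulli_subset.

Lemma mean_ndeg_bernoulli (R : comNzRingType) n (g : sgraph n) (p : R) k :
  \sum_S bernoulli_weight p S * (ndeg k.+1 (attach g S))%:R =
  'C(n, k.+1)%:R * p ^+ k.+1 * (1 - p) ^+ (n - k.+1)
  + (p * (ndeg k g)%:R + (1 - p) * (ndeg k.+1 g)%:R).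
Proof.
rewrite (@mean_ndeg_attach _ n g _ _ id (fun=> p)).
- rewrite bernoulli_weight_card !ndegE !natr_sum !mulr_sumr -big_split /=.
  by congr +%R; apply: eq_bigr => v _; rewrite !(mulrC _%:R).
- exact: sum_bernoulli_weight.
- exact: bernoulli_weight_mem.
Qed.

Lemma sum_pushforward (R : pzSemiRingType) (I T : finType) (W : I -> R) (a : I -> T)
    (F : T -> R) :
  \sum_x (\sum_(i | x == a i) W i) * F x = \sum_i W i * F (a i).
Proof.
under eq_bigr do rewrite mulr_suml.
rewrite (exchange_big_dep predT) //=; apply: eq_bigr => i _.
by rewrite big_pred1_eq.
Qed.

Section one_step.
Context {R : realType} (alpha mu : R).

(** [n] times the probability that a given vertex of degree [k], in a graph with
    [n] vertices, is joined to the next one. *)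
Definition attach_rate n k : R :=
  alpha * k%:R + (1 - alpha) * Num.min mu n%:R.

(** Probability that the next vertex is of the classical kind and has degree [k]. *)
Definition fresh n k : R :=
  (1 - alpha) * ('C(n, k)%:R * (Num.min mu n%:R / n%:R) ^+ k
                 * (1 - Num.min mu n%:R / n%:R) ^+ (n - k)).

(** The recursion behind the theorem, before averaging over [g].  The rate at
    which degree [k.+1] is left is the rate at which degree [k] moves up, and not
    [attach_rate n k.+1], because of the copies. *)
Lemma copy_step_ndeg n (g : sgraph n) k : (0 < n)%N ->
  \sum_h copy_step alpha mu g h * (ndeg k.+1 h)%:R =
  (1 - attach_rate n k / n%:R) * (ndeg k.+1 g)%:R
  + attach_rate n k / n%:R * (ndeg k g)%:R + fresh n k.+1.
Proof.
move=> n0; have n0' : n%:R != 0 :> R by rewrite pnatr_eq0 -lt0n.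
under eq_bigr do rewrite mulrDl -!mulrA.
rewrite big_split /= -!mulr_sumr.
rewrite (sum_pushforward (fun=> n%:R^-1) (fun i => attach g (nbrs g i))).
rewrite (sum_pushforward (bernoulli_weight (Num.min mu n%:R / n%:R)) (attach g)).
rewrite mean_ndeg_copy // mean_ndeg_bernoulli /attach_rate /fresh.
by field.
Qed.

End one_step.

(** * The law of the graph at each time *)
Section finite_valued.
Context {R : realType} d (Omega : measurableType d) (P : probability Omega R).
Context (T : finType) (X : Omega -> T)
  (mX : forall x, measurable [set w | X w = x]%classic).
Local Open Scope classical_set_scope.

Lemma total_probability A : measurable A ->
  P A = (\sum_x P (A `&` [set w | X w = x]))%E.
Proof.
move=> mA; rewrite -big_enum /= fsbig_seq ?enum_uniq //.
rewrite -measure_fin_bigcup //.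
- congr (P _); apply/seteqP; split => [w Aw|w [x _ []]//].
  by exists (X w); rewrite //= mem_enum.
- by move=> x y _ _ [w [[_ /= <-] [_ /= <-]]].
- by move=> x _; exact: measurableI.
Qed.

Lemma measurable_fun_finite (f : T -> R) : measurable_fun setT (f \o X).
Proof.
move=> _ B mB; rewrite setTI.
have -> : (f \o X) @^-1` B = \bigcup_(x in f @^-1` B) [set w | X w = x].
  by apply/seteqP; split => [w Bw|w [x Bx Xw]]; [exists (X w)|rewrite /= Xw].
exact: fin_bigcup_measurable.
Qed.

Lemma expectation_finite (f : T -> R) : (forall x, 0 <= f x) ->
  ('E_P[f \o X] = (\sum_x fine (P [set w | X w = x]) * f x)%:E)%E.
Proof.
move=> f0; rewrite unlock.
have -> : [set: Omega] = \big[setU/set0]_(x <- enum T) [set w | X w = x].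
  rewrite -bigcup_seq; apply/seteqP; split => // w _.
  by exists (X w); rewrite //= mem_enum.
rewrite ge0_integral_bigsetU ?enum_uniq //.
- rewrite big_enum /= -sumEFin; apply: eq_bigr => x _.
  rewrite (@eq_integral _ _ _ _ _ (cst (f x)%:E)); last first.
    by move=> w /set_mem /= ->.
  by rewrite integral_cst // EFinM fineK ?fin_num_measure // muleC.
- by move=> x y _ _ [w [/= <- <-]].
- by apply/measurable_EFinP; apply: measurable_funTS; apply: measurable_fun_finite.
- by move=> w _; rewrite lee_fin; exact: f0.
Qed.

End finite_valued.

Section process.
Context {R : realType} (alpha mu : R) d (Omega : measurableType d)
  (P : probability Omega R) (G : forall t, Omega -> sgraph t.+1).
Context (hG : hard_copying_process alpha mu P G).
Local Open Scope classical_set_scope.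

Lemma measurable_graph t (g : sgraph t.+1) : (1 <= t)%N -> measurable [set w | G t w = g].
Proof. by case: hG => + _ _; apply. Qed.

(** The histories that specify the process are the windows starting at time 1;
    the other ones are needed to forget the past one graph at a time. *)
Definition window s t (g : forall r, sgraph r.+1) :=
  [set w | forall r, (s <= r <= t)%N -> G r w = g r].

Lemma measurable_window s t g : (1 <= s)%N -> measurable (window s t g).
Proof.
move=> s1; apply: bigcap_measurableType => r /andP[sr _].
by apply: measurable_graph; exact: leq_trans sr.
Qed.

Lemma window_dfwith s t g (x : sgraph s.+1) : (s <= t)%N ->
  window s.+1 t g `&` [set w | G s w = x] =
  window s t (eqtype.dfwith g x).
Proof.
move=> st; apply/seteqP; split => [w [Hw Gx] r /andP[sr rt]|w Hw].
  have [sr'|sr'] := eqVneq s r; first by case: r / sr' sr rt; rewrite dfwith_in.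
  by rewrite eqtype.dfwith_out // Hw // rt ltn_neqAle sr' sr.
split => [r /andP[sr rt]|]; last by rewrite /= Hw ?dfwith_in // leqnn st.
by rewrite Hw ?rt ?(ltnW sr) // eqtype.dfwith_out // ltn_eqF.
Qed.

(** The transition probability does not involve the graphs before time [t], so
    the earliest graph of a window can be forgotten by summing over its values. *)
Lemma window_step s t g : (1 <= s <= t)%N ->
  P (window s t g `&` [set w | G t.+1 w = g t.+1]) =
  (P (window s t g) * (copy_step alpha mu (g t) (g t.+1))%:E)%E.
Proof.
case/andP => s1; elim: s s1 g => // -[_ _ g t1|s IH _ g st].
  by case: hG => _ _ /(_ t g t1).
have st' : (s.+1 <= t)%N by exact: ltnW.
rewrite (@total_probability _ _ _ _ _ (G s.+1)); last 2 first.
- by move=> x; exact: measurable_graph.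
- by apply: measurableI; [exact: measurable_window|exact: measurable_graph].
rewrite [in RHS](@total_probability _ _ _ _ _ (G s.+1)); last 2 first.
- by move=> x; exact: measurable_graph.
- exact: measurable_window.
rewrite ge0_sume_distrl; last by move=> x _; exact: measure_ge0.
apply: eq_bigr => x _; rewrite setIAC window_dfwith //.
have := IH isT (eqtype.dfwith g x) st'.
by rewrite !eqtype.dfwith_out // ltn_eqF // ltnS ltnW.
Qed.

Lemma markov_step t (g : sgraph t.+1) (h : sgraph t.+2) : (1 <= t)%N ->
  P ([set w | G t w = g] `&` [set w | G t.+1 w = h]) =
  (P [set w | G t w = g] * (copy_step alpha mu g h)%:E)%E.
Proof.
move=> t1; have [[w0 <-]|nog] := pselect (exists w, G t w = g); last first.
  rewrite (_ : [set w | G t w = g] = set0) ?set0I ?measure0 ?mul0e //.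
  by apply/seteqP; split => // w Gw; apply: nog; exists w.
(* A sequence of graphs passing through [g] and [h]: a trajectory that visits
   [g] at time [t], with its next graph replaced by [h]. *)
pose f := eqtype.dfwith (fun s => G s w0) h.
have ft : f t = G t w0 by rewrite /f eqtype.dfwith_out // gtn_eqF.
have fSt : f t.+1 = h by rewrite /f eqtype.dfwith_in.
have := @window_step t t f; rewrite t1 leqnn ft fSt => /(_ isT).
rewrite (_ : window t t f = [set w | G t w = G t w0]) //.
apply/seteqP; split => w /= Hw; first by rewrite Hw ?ft // leqnn.
by move=> r; rewrite -eqn_leq => /eqP <-; rewrite ft.
Qed.

Definition law t (g : sgraph t.+1) : R := fine (P [set w | G t w = g]).

Definition mean_deg_count (k t : nat) : R := \sum_g @law t g * (ndeg k g)%:R.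

Lemma law_ge0 t (g : sgraph t.+1) : 0 <= law g.
Proof. by rewrite fine_ge0. Qed.

Lemma mean_ndegE k t : (1 <= t)%N ->
  mean_ndeg P G k t = (mean_deg_count k t)%:E.
Proof.
move=> t1; rewrite /mean_ndeg /mean_deg_count.
rewrite (@expectation_finite _ _ _ _ _ (G t) _ (fun g => (ndeg k g)%:R)) // => g.
exact: measurable_graph.
Qed.

Lemma sum_law t : (1 <= t)%N -> \sum_g @law t g = 1.
Proof.
move=> t1; apply: EFin_inj; rewrite -sumEFin -[RHS](@probability_setT _ _ _ P).
rewrite (@total_probability _ _ _ _ _ (G t)) //; last by move=> g; exact: measurable_graph.
by apply: eq_bigr => g _; rewrite setTI fineK // fin_num_measure //; exact: measurable_graph.
Qed.

Lemma law_step t (h : sgraph t.+2) : (1 <= t)%N ->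
  law h = \sum_g law g * copy_step alpha mu g h.
Proof.
move=> t1; apply: EFin_inj.
rewrite -sumEFin fineK ?fin_num_measure //; last exact: measurable_graph.
rewrite (@total_probability _ _ _ _ _ (G t)); last 2 first.
- by move=> x; exact: measurable_graph.
- exact: measurable_graph.
apply: eq_bigr => g _; rewrite setIC markov_step // EFinM fineK //.
by rewrite fin_num_measure //; exact: measurable_graph.
Qed.

End process.

(** * Eventual bounds and limits *)

Section limn.
Context {R : realType}.
Local Open Scope classical_set_scope.
Implicit Types (u : nat -> \bar R) (l : \bar R).

Lemma limn_esup_le_near u l N :
  (forall t, (N <= t)%N -> (u t <= l)%E) -> (limn_esup u <= l)%E.
Proof.
move=> ul; rewrite /limn_esup limf_esupE; apply: ereal_inf_le.
exists (ereal_sup (u @` [set t | (N <= t)%N])).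
  by exists [set t | (N <= t)%N] => //; exists N.
by apply: ge_ereal_sup => _ [t /= Nt <-]; exact: ul.
Qed.

Lemma limn_einf_ge_near u l N :
  (forall t, (N <= t)%N -> (l <= u t)%E) -> (l <= limn_einf u)%E.
Proof.
move=> lu; rewrite /limn_einf leeNr; apply: (@limn_esup_le_near _ _ N) => t Nt.
by rewrite leeN2 lu.
Qed.

End limn.

(** * Power functions *)

Section power.
Context {R : realType} (alpha : R) (alpha01 : 0 < alpha < 1).

(** Young's inequality for the exponents [alpha^-1] and [(1 - alpha)^-1], one of
    the two factors being 1.  Up to scaling it is Bernoulli's inequality. *)
Lemma bernoulli_powR y : 0 <= y -> y - (1 - alpha) <= alpha * y `^ alpha^-1.
Proof.
move=> y0; have /andP[a0 a1] := alpha01.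
have := @conjugate_powR R y 1 alpha^-1 (1 - alpha)^-1 y0 ler01.
rewrite !invr_gt0 !invrK powR1 mulr1 mul1r => /(_ a0) H.
rewrite lerBlDr mulrC; apply: H; lra.
Qed.

Lemma powRN_div (x y b : R) : 0 < x -> 0 < y ->
  (y / x) `^ b * y `^ (- b) = x `^ (- b).
Proof.
move=> x0 y0; rewrite powRM ?invr_ge0 ?ltW // -[x^-1]powR_inv1 ?ltW //.
rewrite -powRrM mulN1r mulrAC -powRD; last by rewrite (gt_eqF y0) implybT.
by rewrite subrr powRr0 mul1r.
Qed.

(** With [x = k + r] and [a = alpha * x], a sequence equal to
    [(k + r) `^ (- alpha^-1)] satisfies [(1 + a) * w k.+1 <= a * w k]. *)
Lemma powR_subsolution x : 0 < x ->
  (1 + alpha * x) * (x + 1) `^ (- alpha^-1) <= alpha * x * x `^ (- alpha^-1).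
Proof.
move=> x0; have /andP[a0 a1] := alpha01; have x10 : 0 < x + 1 by lra.
rewrite -(powRN_div _ x0 x10) mulrA ler_wpM2r ?powR_ge0 //.
have /bernoulli_powR : 0 <= (x + 1) / x by rewrite divr_ge0 // ltW.
move: (_ `^ _) => Y /(ler_wpM2l (ltW x0)).
by rewrite mulrBr mulrCA divff ?gt_eqF // => H; lra.
Qed.

(** With [z = k + r + alpha^-1] and [a = alpha * (k + r)], so that
    [alpha * z = 1 + a], the sequence of general term
    [(k + r + alpha^-1 - 1) `^ (- alpha^-1)] satisfies
    [a * w k <= (1 + a) * w k.+1]. *)
Lemma powR_supersolution z : 1 < z ->
  (alpha * z - 1) * (z - 1) `^ (- alpha^-1) <= alpha * z * z `^ (- alpha^-1).
Proof.
move=> z1; have /andP[a0 a1] := alpha01.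
have z0 : 0 < z by lra.
have z10 : 0 < z - 1 by lra.
rewrite -(powRN_div _ z0 z10) mulrA ler_wpM2r ?powR_ge0 //.
have /bernoulli_powR : 0 <= (z - 1) / z by rewrite divr_ge0 // ltW.
move: (_ `^ _) => Y /(ler_wpM2l (ltW z0)).
by rewrite mulrBr mulrCA divff ?gt_eqF // => H; lra.
Qed.

Lemma powR_le_expR (y b : R) : 0 < y -> 0 <= b -> y `^ b <= expR (b * y).
Proof.
move=> y0 b0; rewrite /powR gt_eqF // ler_expR ler_wpM2l //.
by rewrite ltW // ln_sublinear.
Qed.

Lemma ler_powRN (x y b : R) : 0 < x -> x <= y -> 0 <= b ->
  y `^ (- b) <= x `^ (- b).
Proof.
move=> x0 xy b0; rewrite !powRN lef_pV2 ?posrE ?powR_gt0 ?(lt_le_trans x0) //.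
by rewrite ge0_ler_powR // nnegrE ?(ltW x0) // (le_trans (ltW x0)).
Qed.

End power.

Lemma series_exp_coeff_le (R : realType) (y : R) k : 0 <= y ->
  series (exp_coeff y) k <= expR y.
Proof.
move=> y0; apply: nondecreasing_cvgn_le; last exact: is_cvg_series_exp_coeff.
by apply: nondecreasing_series => n _ _; exact: exp_coeff_ge0.
Qed.

(** * The recursion for the expected degree counts *)

Lemma ffact_le_expn n k : (n ^_ k <= n ^ k)%N.
Proof.
elim: k => [|k IH]; first by rewrite ffactn0.
by rewrite ffactnSr expnSr leq_mul // leq_subr.
Qed.

Section recursion.
Context {R : realType} (alpha mu : R) (alpha01 : 0 < alpha < 1) (mu0 : 0 < mu).

(** What the asymptotic analysis uses about the expected number [D k t] of
    vertices of degree [k] at time [t], when there are [t.+1] vertices. *)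
Record degree_recursion (D : nat -> nat -> R) : Prop := DegreeRecursion {
  rec_ge0 : forall k t, (1 <= t)%N -> 0 <= D k t;
  rec_le : forall k t, (1 <= t)%N -> D k t <= t.+1%:R;
  rec_eq0 : forall k t, (1 <= t < k)%N -> D k t = 0;
  rec_step : forall k t, (1 <= t)%N ->
    D k.+1 t.+1 = (1 - attach_rate alpha mu t.+1 k / t.+1%:R) * D k.+1 t
      + attach_rate alpha mu t.+1 k / t.+1%:R * D k t
      + fresh alpha mu t.+1 k.+1 }.

Lemma min_ratio_itv n : (0 < n)%N -> 0 <= Num.min mu n%:R / n%:R <= 1.
Proof.
move=> n0; have n0' : 0 < n%:R :> R by rewrite ltr0n.
rewrite divr_ge0 ?ler0n ?le_min ?ler0n ?(ltW mu0) //.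
by rewrite ler_pdivrMr // mul1r ge_min lexx orbT.
Qed.

Lemma fresh_ge0 n k : (0 < n)%N -> 0 <= fresh alpha mu n k.
Proof.
move=> n0; have /andP[p0 p1] := min_ratio_itv n0; have /andP[a0 a1] := alpha01.
by rewrite /fresh !mulr_ge0 ?exprn_ge0 ?subr_ge0 // ltW.
Qed.

(** A bound by [mu ^ k / k!], uniform in [n], from ['C(n, k) <= n ^ k / k!]. *)
Lemma fresh_le n k : (0 < n)%N -> fresh alpha mu n k <= exp_coeff mu k.
Proof.
move=> n0; have /andP[p0 p1] := min_ratio_itv n0.
have n0' : 0 < n%:R :> R by rewrite ltr0n.
have kf : 0 < k`!%:R :> R by rewrite ltr0n fact_gt0.
rewrite /fresh /exp_coeff /=; apply: (@le_trans _ _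
  ('C(n, k)%:R * (Num.min mu n%:R / n%:R) ^+ k)).
  have q1 : (1 - Num.min mu n%:R / n%:R) ^+ (n - k) <= 1.
    by rewrite exprn_ile1 //; lra.
  have q0 : 0 <= (1 - Num.min mu n%:R / n%:R) ^+ (n - k).
    by rewrite exprn_ge0 //; lra.
  have C0 : 0 <= 'C(n, k)%:R * (Num.min mu n%:R / n%:R) ^+ k.
    by rewrite mulr_ge0 // exprn_ge0.
  have /andP[a0 a1] := alpha01.
  rewrite mulrA (mulrC (1 - alpha)) -mulrA ler_piMr //.
  by rewrite mulr_ile1 //; lra.
rewrite ler_pdivlMr // mulrAC -natrM bin_ffact expr_div_n mulrA.
rewrite ler_pdivrMr ?exprn_gt0 // mulrC ler_pM ?exprn_ge0 //.
- by rewrite le_min ler0n ltW.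
- by rewrite lerXn2r ?nnegrE ?le_min ?ler0n ?(ltW mu0) // ge_min lexx.
- by rewrite -natrX ler_nat ffact_le_expn.
Qed.

Lemma one_sub_ge_expR (x : R) : 0 <= x <= 2^-1 -> expR (- (2 * x)) <= 1 - x.
Proof.
case/andP=> x0 x1; have y0 : 0 < 1 - x by lra.
rewrite expRN -[leRHS]invrK lef_pV2 ?posrE ?expR_gt0 ?invr_gt0 //.
apply: le_trans (expR_ge1Dx _); rewrite -[leLHS]mul1r ler_pdivrMr //.
by nra.
Qed.

Lemma fresh1_ge n : (0 < n)%N -> 2 * mu <= n%:R ->
  (1 - alpha) * (mu * expR (- (2 * mu))) <= fresh alpha mu n 1.
Proof.
move=> n0 mun; have /andP[a0 a1] := alpha01.
have n0' : 0 < n%:R :> R by rewrite ltr0n.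
rewrite /fresh ler_wpM2l ?subr_ge0 ?(ltW a1) //.
have -> : Num.min mu n%:R = mu by rewrite min_l //; lra.
rewrite bin1 expr1 mulrCA divff ?gt_eqF // mulr1 ler_wpM2l ?(ltW mu0) //.
have p01 : 0 <= mu / n%:R <= 2^-1.
  by rewrite divr_ge0 ?(ltW mu0) ?(ltW n0') //= ler_pdivrMr //; lra.
apply: (@le_trans _ _ ((1 - mu / n%:R) ^+ n)).
  rewrite (_ : - (2 * mu) = - (2 * (mu / n%:R)) * n%:R); last by field; rewrite gt_eqF.
  by rewrite expRM_natr lerXn2r ?nnegrE ?expR_ge0 ?one_sub_ge_expR //; lra.
by rewrite ler_wiXn2l ?leq_subr //; lra.
Qed.


Lemma attach_rateE n k : mu <= n%:R ->
  attach_rate alpha mu n k = alpha * k%:R + (1 - alpha) * mu.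
Proof. by move=> mun; rewrite /attach_rate min_l. Qed.

Let b : R := (1 - alpha) * mu.
Let r : R := b / alpha.
Let beta : R := alpha^-1.

Let a0 : 0 < alpha. Proof. by case/andP: alpha01. Qed.
Let a1 : alpha < 1. Proof. by case/andP: alpha01. Qed.
Let b0 : 0 < b. Proof. by rewrite /b mulr_gt0 // subr_gt0. Qed.
Let r0 : 0 < r. Proof. by rewrite /r divr_gt0. Qed.
Let beta1 : 1 < beta. Proof. by rewrite /beta invf_gt1. Qed.
Let ar : alpha * r = b. Proof. by rewrite /r mulrCA divff ?mulr1 // gt_eqF. Qed.
Let ab : alpha * beta = 1. Proof. by rewrite /beta divff // gt_eqF. Qed.

(** The error [- M] of the source term is harmless: it enters with the factor
    [a / t.+1], the same factor with which the additive constant [M'] of the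
    claim is damped, so any [M' >= M] is stable under the recursion. *)
Lemma linear_lower_bound (X : nat -> R) (a e w M : R) T :
  0 <= a -> 0 <= M -> 0 <= w -> (1 + a) * w <= e ->
  (forall t, (T <= t)%N -> 0 <= X t) ->
  (forall t, (T <= t)%N ->
    (1 - a / t.+1%:R) * X t + (e - a / t.+1%:R * M) <= X t.+1) ->
  exists (M' : R) (T' : nat), 0 <= M' /\
    forall t, (T' <= t)%N -> w * t.+1%:R - M' <= X t.
Proof.
move=> ha hM hw he X0 hX.
(* The recursion is monotone in [X t] only when [a <= t.+1]. *)
pose T' := maxn T (Num.truncn a).
exists (M + w * T'.+1%:R), T'; split.
  by rewrite addr_ge0 // mulr_ge0.
move=> t /subnKC <-; elim: (t - T')%N => [|i IH].
  rewrite addn0; apply: le_trans (X0 _ (leq_maxl _ _)).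
  by rewrite opprD addrCA subrr addr0 oppr_le0.
set s := (T' + i)%N in IH *; rewrite addnS -/s.
have Ts : (T' <= s)%N by exact: leq_addr.
have {}hX := hX s (leq_trans (leq_maxl _ _) Ts).
have n0 : 0 < s.+1%:R :> R by [].
have an : a <= s.+1%:R.
  rewrite (le_trans (ltW (truncnS_gt a))) // ler_nat ltnS.
  by rewrite (leq_trans (leq_maxr _ _) Ts).
rewrite -natr1; move: s.+1%:R n0 an IH hX => n n0 an IH hX.
set M' := M + _ in IH *.
have MM' : M <= M' by rewrite lerDl mulr_ge0.
set q := a / n in hX; have qn : q * n = a by rewrite /q divfK // gt_eqF.
have q0 : 0 <= q by rewrite divr_ge0 // ltW.
have q1 : 0 <= 1 - q by rewrite subr_ge0 ler_pdivrMr // mul1r.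
have := ler_wpM2l q1 IH; have := ler_wpM2l q0 MM'.
have -> : (1 - q) * (w * n - M') = w * n - M' - a * w + q * M'.
  by rewrite -qn; ring.
move=> *; lra.
Qed.

(** The constant [M] depends on [k], unlike [c]; it is negligible against
    [t.+1] for each fixed [k]. *)
Lemma lower_bound : exists2 c : R, 0 < c &
  forall D, degree_recursion D -> forall k, (1 <= k)%N ->
  exists (M : R) (T : nat), forall t, (T <= t)%N ->
    c * k%:R `^ (- alpha^-1) * t.+1%:R - M <= D k t.
Proof.
pose e : R := (1 - alpha) * (mu * expR (- (2 * mu))).
have e0 : 0 < e by rewrite !mulr_gt0 ?subr_gt0 ?expR_gt0.
have p1 : 0 < (1 + r) `^ (- beta) by rewrite powR_gt0 // addr_gt0.
have b1 : 0 < 1 + b by rewrite addr_gt0.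
(* Chosen so that the profile [w k = c * (k + r) `^ (- beta)] satisfies
   [(1 + b) * w 1 = e], the balance at degree 1. *)
pose c : R := e / (1 + b) / (1 + r) `^ (- beta).
have c0 : 0 < c by rewrite !divr_gt0 // addr_gt0.
pose T0 := (Num.truncn (2 * mu)).+1.
have T0P t : (T0 <= t)%N -> (1 <= t)%N /\ 2 * mu <= t.+1%:R.
  move=> Tt; split; first exact: leq_trans Tt.
  by rewrite (le_trans (ltW (truncnS_gt _))) // ler_nat ltnW.
have rateE t k : (T0 <= t)%N -> attach_rate alpha mu t.+1 k = alpha * (k%:R + r).
  case/T0P=> _ mut; rewrite mulrDr ar attach_rateE //.
  by apply: le_trans mut; rewrite ler_peMl ?ltW // ltr1n.
suff profile D : degree_recursion D -> forall k, (1 <= k)%N ->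
    exists (M : R) (T : nat), 0 <= M /\ forall t, (T <= t)%N ->
      c * (k%:R + r) `^ (- beta) * t.+1%:R - M <= D k t.
  exists (c * (1 + r) `^ (- beta)); first by rewrite mulr_gt0.
  move=> D hD k k1; have [M [T [_ HM]]] := profile D hD k k1.
  exists M, T => t Tt; apply: le_trans (HM t Tt).
  rewrite lerD2r ler_pM2r // -mulrA ler_pM2l // -powRM // ?addr_ge0 ?(ltW r0) //.
  rewrite ler_powRN ?invr_ge0 ?(ltW a0) //.
    by rewrite addr_gt0 // ltr0n.
  by rewrite mulrDl mul1r lerD2l ler_peMr ?ler1n // ltW.
move=> hD; elim=> // -[_ _|k IH _].
  apply: (@linear_lower_bound (D 1%N) b e _ 0 T0) => //.
  - exact: ltW.
  - by rewrite mulr_ge0 ?powR_ge0 ?ltW.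
  - by rewrite /c divfK ?(gt_eqF p1) // mulrCA divff ?mulr1 // (gt_eqF b1).
  - by move=> t /T0P[t1 _]; exact: (rec_ge0 hD).
  - move=> t Tt; have [t1 mut] := T0P _ Tt.
    rewrite (rec_step hD) // rateE // mulr0n add0r ar mulr0 subr0 -addrA lerD2l.
    apply: le_trans (fresh1_ge (ltn0Sn t) mut) _.
    by rewrite lerDr mulr_ge0 ?(rec_ge0 hD) // divr_ge0 // ltW.
have [M [T [M0 HM]]] := IH isT.
set w := c * _ in HM.
have kr0 : 0 < k.+1%:R + r by rewrite addr_gt0.
pose a : R := alpha * (k.+1%:R + r).
have a0' : 0 < a by rewrite mulr_gt0.
apply: (@linear_lower_bound (D k.+2) a (a * w) _ M (maxn T0 T)) => //.
- exact: ltW.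
- by rewrite mulr_ge0 ?powR_ge0 ?ltW.
- have := powR_subsolution alpha01 kr0; rewrite -/beta.
  rewrite -addrA (addrC r) addrA natr1 -/a => /(ler_wpM2l (ltW c0)).
  by rewrite mulrCA [leRHS]mulrCA.
- by move=> t; rewrite geq_max => /andP[/T0P[t1 _] _]; exact: (rec_ge0 hD).
- move=> t; rewrite geq_max => /andP[Tt Tt']; have [t1 mut] := T0P _ Tt.
  rewrite (rec_step hD) // rateE // -/a -addrA lerD2l.
  have f0 := fresh_ge0 k.+2 (ltn0Sn t).
  have q0 : 0 <= a / t.+1%:R by rewrite divr_ge0 ?ltW.
  have := ler_wpM2l q0 (HM _ Tt').
  have -> : a / t.+1%:R * (w * t.+1%:R - M) = a * w - a / t.+1%:R * M.
    by field; rewrite gt_eqF.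
  by move=> H; apply: (le_trans H); rewrite lerDl.
Qed.

(** The bound holds for all [k] from one common time on: for [k] larger than the
    number of vertices there is nothing to prove, and for the other ones the
    coefficient [1 - a / t.+1] of the recursion is nonnegative as soon as
    [mu <= t.+1], by [alpha < 1]. *)
Lemma upper_bound : exists2 C : R, 0 < C &
  exists T, forall D, degree_recursion D -> forall k t, (1 <= k)%N ->
  (T <= t)%N -> D k t <= C * k%:R `^ (- alpha^-1) * t.+1%:R.
Proof.
pose s : R := r + (beta - 1).
have s0 : 0 < s by rewrite addr_gt0 // subr_gt0.
have beta0 : 0 < beta by apply: lt_trans beta1.
pose f k : R := (k%:R + s) `^ (- beta).
have ks0 k : 0 < k%:R + s by rewrite ltr_wpDl.
have f0 k : 0 < f k by rewrite powR_gt0.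
have f_nincr j k : (j <= k)%N -> f k <= f j.
  by move=> jk; rewrite ler_powRN ?lerD2r ?ler_nat // ltW.
have f_super k : alpha * (k%:R + r) * f k <= (1 + alpha * (k%:R + r)) * f k.+1.
  have z1 : 1 < k%:R + r + beta by rewrite ltr_wpDl // addr_ge0 // ltW.
  have := powR_supersolution alpha01 z1; rewrite -/beta mulrDr ab addrK.
  have -> : k%:R + r + beta - 1 = k%:R + s by rewrite /s !addrA.
  have -> : k%:R + r + beta = k.+1%:R + s by rewrite /s -natr1; ring.
  by rewrite [_ + 1]addrC.
pose T := maxn 1 (Num.truncn mu).
(* Large enough for the profile to exceed 1, hence [D k t <= t.+1], at the
   starting time, for every degree that can occur then. *)
pose A : R := (f T.+1)^-1.
have A0 : 0 < A by rewrite invr_gt0.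
pose B : R := expR (beta * s).
have B0 : 0 <= B by rewrite expR_ge0.
pose y : R := mu * expR beta.
have y0 : 0 <= y by rewrite mulr_ge0 ?expR_ge0 ?ltW.
(* [B * exp_coeff y j] bounds the quotient of the source term [mu ^ j / j!] by
   [f j], as [(j + s) `^ beta <= expR (beta * (j + s))]. *)
pose S k : R := A + B * series (exp_coeff y) k.+1.
have S_incr k : S k.+1 = S k + B * exp_coeff y k.+1.
  by rewrite /S (seriesSr _ k.+1) mulrDr addrA.
have AS k : A <= S k.
  rewrite lerDl mulr_ge0 // sumr_ge0 // => i _.
  exact: exp_coeff_ge0.
have SC k : S k <= A + B * expR y.
  by rewrite lerD2l ler_wpM2l // series_exp_coeff_le.
have S0 k : 0 < S k by apply: lt_le_trans (AS k).
have f_fresh k : exp_coeff mu k <= f k * (B * exp_coeff y k).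
  have -> : f k * (B * exp_coeff y k) =
      exp_coeff mu k * (f k * (B * expR (beta * k%:R))).
    by rewrite /exp_coeff /= exprMn -expRM_natr; ring.
  rewrite ler_peMr ?exp_coeff_ge0 ?(ltW mu0) //.
  rewrite /f powRN mulrC ler_pdivlMr ?mul1r ?powR_gt0 //.
  rewrite /B -expRD -mulrDr [s + _]addrC.
  by apply: powR_le_expR; [exact: ks0|exact: ltW].
(* The supersolution absorbs the transfer from degree [k], and the increment of
   [S] the source term. *)
have W_super k : alpha * (k%:R + r) * (f k * S k) + exp_coeff mu k.+1 <=
    (1 + alpha * (k%:R + r)) * (f k.+1 * S k.+1).
  have := ler_wpM2r (ltW (S0 k)) (f_super k); rewrite -(mulrA _ (f k)) => H1.
  have a0' : 0 <= alpha * (k%:R + r) by rewrite mulr_ge0 ?addr_ge0 // ltW.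
  have g0 : 0 <= f k.+1 * (B * exp_coeff y k.+1).
    by rewrite mulr_ge0 ?(ltW (f0 _)) // mulr_ge0 ?exp_coeff_ge0.
  apply: le_trans (lerD H1 (f_fresh k.+1)) _.
  rewrite S_incr [leRHS](_ : _ = (1 + alpha * (k%:R + r)) * f k.+1 * S k
    + (1 + alpha * (k%:R + r)) * (f k.+1 * (B * exp_coeff y k.+1))); last by ring.
  by rewrite lerD2l ler_peMl // lerDl.
have W1 k : (k <= T.+1)%N -> 1 <= f k * S k.
  move=> kT; apply: (@le_trans _ _ (f T.+1 * A)); first by rewrite mulfV // gt_eqF.
  by rewrite ler_pM ?f_nincr // ltW.
exists (A + B * expR y).
  by rewrite ltr_pwDl // mulr_ge0 ?expR_ge0.
exists T => D hD.
have T_ge1 : (1 <= T)%N by exact: leq_maxl.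
suff DW k t : (T <= t)%N -> D k t <= f k * S k * t.+1%:R.
  move=> k t k1 Tt; apply: le_trans (DW _ _ Tt) _.
  rewrite ler_wpM2r // mulrC ler_pM ?(ltW (S0 _)) ?(ltW (f0 _)) //.
  by rewrite ler_powRN ?ltr0n ?lerDl ?(ltW s0) ?(ltW beta0).
move=> Tt; rewrite -(subnKC Tt); elim: (t - T)%N k => [|i IH] k.
  rewrite addn0; have [kT|Tk] := leqP k T.+1.
    apply: (le_trans (rec_le hD _ T_ge1)).
    by rewrite ler_peMl // W1.
  by rewrite (rec_eq0 hD) ?mulr_ge0 ?(ltW (S0 _)) ?(ltW (f0 _)) // T_ge1 ltnW.
have Ti : (1 <= T + i)%N by exact: leq_trans (leq_addr _ _).
rewrite addnS; move: (T + i)%N Ti (leq_addr i T) IH => u u1 Tu IH.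
case: k => [|k].
  apply: (le_trans (rec_le hD _ _)) => //.
  by rewrite ler_peMl // W1.
have [uk|ku] := ltnP u k.
  by rewrite (rec_eq0 hD) ?mulr_ge0 ?(ltW (S0 _)) ?(ltW (f0 _)).
have n0 : 0 < u.+1%:R :> R by [].
have mun : mu <= u.+1%:R.
  rewrite (le_trans (ltW (truncnS_gt mu))) // ler_nat ltnS.
  exact: leq_trans (leq_maxr _ _) Tu.
rewrite (rec_step hD) // attach_rateE //.
have -> : alpha * k%:R + (1 - alpha) * mu = alpha * (k%:R + r).
  by rewrite mulrDr ar.
have := W_super k; set a : R := alpha * (k%:R + r).
set w := f k * S k; set w' := f k.+1 * S k.+1 => Ww.
have an : a <= u.+1%:R.
  rewrite /a mulrDr ar [leRHS](_ : _ = alpha * u.+1%:R + (1 - alpha) * u.+1%:R).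
    by rewrite lerD ?ler_wpM2l ?subr_ge0 ?(ltW a1) ?(ltW a0) // ler_nat leqW.
  by ring.
have q0 : 0 <= a / u.+1%:R.
  by rewrite divr_ge0 // mulr_ge0 ?addr_ge0 ?(ltW r0) // ltW.
have q1 : 0 <= 1 - a / u.+1%:R by rewrite subr_ge0 ler_pdivrMr // mul1r.
apply: (le_trans (lerD (lerD (ler_wpM2l q1 (IH k.+1)) (ler_wpM2l q0 (IH k)))
  (fresh_le k.+1 (ltn0Sn u)))).
rewrite -/w -/w' [leLHS](_ : _ =
    w' * u.+1%:R - a * w' + (a * w + exp_coeff mu k.+1)).
  apply: (le_trans (lerD (lexx _) Ww)).
  by rewrite [leLHS](_ : _ = w' * (u.+1%:R + 1)) ?natr1 //; ring.
by field; rewrite gt_eqF.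
Qed.

End recursion.

(** * The theorem *)

Section main.
Context {R : realType} (alpha mu : R) d (Omega : measurableType d)
  (P : probability Omega R) (G : forall t, Omega -> sgraph t.+1).
Context (hG : hard_copying_process alpha mu P G).

Lemma mean_deg_count_recursion :
  degree_recursion alpha mu (mean_deg_count P G).
Proof.
split=> [k t t1|k t t1|k t /andP[t1 tk]|k t t1].
- by rewrite sumr_ge0 // => g _; rewrite mulr_ge0 ?law_ge0.
- rewrite -[leRHS]mul1r -[X in _ <= X * _](sum_law hG t1) mulr_suml.
  apply: ler_sum => g _.
  by rewrite ler_wpM2l ?law_ge0 // ler_nat ndeg_le.
- by rewrite /mean_deg_count big1 // => g _; rewrite ndeg_eq0 ?mulr0.
- rewrite /mean_deg_count.
  under eq_bigr do rewrite (law_step hG) // mulr_suml.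
  rewrite exchange_big /=.
  under eq_bigr do under eq_bigr do rewrite -mulrA.
  under eq_bigr do rewrite -mulr_sumr copy_step_ndeg //.
  rewrite [X in _ = _ + X](_ : _ = 
      \sum_g @law _ _ _ P G t g * fresh alpha mu t.+1 k.+1);
    last by rewrite -mulr_suml (sum_law hG) // mul1r.
  rewrite !mulr_sumr.
  by rewrite -!big_split /=; apply: eq_bigr => g _; ring.
Qed.

End main.

Theorem theorem6p2 (R : realType) (alpha mu : R) :
  0 < alpha < 1 -> 0 < mu ->
  exists C1 C2 : R, [/\ 0 < C1, 0 < C2 &
    forall (d : measure_display) (Omega : measurableType d)
      (P : probability Omega R) (G : forall t, Omega -> sgraph t.+1),
    hard_copying_process alpha mu P G ->
    forall k : nat, (1 <= k)%N ->
      let u := fun t : nat => (mean_ndeg P G k t * (t%:R^-1)%:E)%E in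
      [/\ ((C1 * (k%:R `^ (- alpha^-1)))%:E <= limn_einf u)%E,
          (limn_einf u <= limn_esup u)%E &
          (limn_esup u <= (C2 * (k%:R `^ (- alpha^-1)))%:E)%E]].
Proof.
move=> alpha01 mu0; have /andP[a0 a1] := alpha01.
have [c c0 lower] := lower_bound alpha01 mu0.
have [C C0 [T upper]] := upper_bound alpha01 mu0.
(* The factors [1 / 2] and [2] absorb the additive constant of the lower bound and
   the quotient of [t.+1] by [t]. *)
exists (c / 2), (2 * C); split; [exact: divr_gt0|exact: mulr_gt0|].
move=> d Omega P G hG k k1 /=.
have hD := mean_deg_count_recursion hG.
have uE t : (1 <= t)%N -> (mean_ndeg P G k t * (t%:R^-1)%:E)%E
    = (mean_deg_count P G k t / t%:R)%:E.
  by move=> t1; rewrite (mean_ndegE hG).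
split; [|exact: limn_einf_sup|].
- have [M [T1 HM]] := lower _ hD k k1.
  rewrite mulrAC; set w := c * _ in HM *.
  have w0 : 0 < w by rewrite mulr_gt0 // powR_gt0 // ltr0n.
  pose T2 := (Num.truncn (M / w * 2)).+1.
  apply: (@limn_einf_ge_near _ _ _ (maxn (maxn 1 T1) T2)) => t.
  rewrite !geq_max -andbA => /and3P[t1 Tt Mt].
  have t0 : 0 < t%:R :> R by rewrite ltr0n.
  rewrite uE // lee_fin ler_pdivlMr //; apply: le_trans (HM _ Tt).
  have Mt' : M * 2 <= w * t%:R.
    have : M / w * 2 <= t%:R.
      by rewrite (le_trans (ltW (truncnS_gt _))) // ler_nat.
    by rewrite mulrAC ler_pdivrMr // [_ * w]mulrC.
  by rewrite -(natr1 t); lra.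
- apply: (@limn_esup_le_near _ _ _ (maxn 1 T)) => t.
  rewrite geq_max => /andP[t1 Tt]; have t0 : 0 < t%:R :> R by rewrite ltr0n.
  rewrite uE // lee_fin ler_pdivrMr //; apply: le_trans (upper _ hD _ _ k1 Tt) _.
  rewrite (_ : 2 * C * _ * _ = C * k%:R `^ (- alpha^-1) * (2 * t%:R)); last by ring.
  rewrite ler_wpM2l ?mulr_ge0 ?powR_ge0 ?(ltW C0) //.
  by rewrite -natrM ler_nat mul2n -addnn -addn1 leq_add2l.
Qed.
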